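(* Assume $\mathfrak b=\mathfrak c$. Then there is a countable Hausdorff 0-dimensional Fréchet-Urysohn space that is not H-separable and has $\pi$-weight $\mathfrak c$.
   Context: A space is 0-dimensional if it has a base consisting of clopen sets. A space $X$ is Fréchet-Urysohn if for every $A\subset X$ and $x\in\overline{A}\setminus A$ there is a sequence $S\subset A$ converging to $x$. A space $X$ is H-separable if for every sequence $\{D_n : n\in\omega\}$ of dense subsets of $X$ there is a selection of finite sets $F_n\subset D_n$ ($n\in\omega$) such that for every infinite $A\subset\omega$ the set $\bigcup\{F_n : n\in A\}$ is dense in $X$. The $\pi$-weight of $X$ is the least cardinality of a $\pi$-base, i.e. of a family of nonempty open sets such that every nonempty open set contains a member of the family. $\mathfrak c=2^{\aleph_0}$, and $\mathfrak b$ is the least cardinality of a subset of $\omega^\omega$ that is unbounded with respect to the mod finite order $<^*$. *)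

(* Defs.v *)
From mathcomp Require Import all_boot all_order.
From mathcomp Require Import boolp classical_sets functions cardinality filter.
From mathcomp Require Import topology.

Set Implicit Arguments.
Unset Strict Implicit.
Unset Printing Implicit Defensive.

Local Open Scope classical_set_scope.
Local Open Scope card_scope.

(* A cardinal is represented by any set of that cardinality, so [least_card P K]
   reads: the least cardinality of a set satisfying P exists and equals |K|. *)
Definition least_card (T U : Type) (P : set (set T)) (K : set U) : Prop :=
  (exists2 A, P A & A #= K) /\ (forall A, P A -> K #<= A).

Definition continuum : set (set nat) := setT.

Definition lt_mod_finite (f g : nat -> nat) : Prop :=
  \forall n \near \oo, f n < g n.

Definition unbounded (B : set (nat -> nat)) : Prop :=
  ~ exists g, forall f, B f -> lt_mod_finite f g.

Definition bounding_number_eq (U : Type) (K : set U) : Prop :=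
  least_card unbounded K.

(* The library's [zero_dimensional] only separates points by clopen sets, which
   is weaker than having a clopen base. *)
Definition has_clopen_base (X : topologicalType) : Prop :=
  exists2 B : set (set X), B `<=` clopen & basis B.

Definition frechet_urysohn (X : topologicalType) : Prop :=
  forall (A : set X) (x : X), (closure A `\` A) x ->
    exists2 s : nat -> X, (forall n, A (s n)) & s @ \oo --> x.

Definition H_separable (X : topologicalType) : Prop :=
  forall D : nat -> set X, (forall n, dense (D n)) ->
    exists F : nat -> set X,
      (forall n, finite_set (F n) /\ F n `<=` D n) /\
      (forall A : set nat, infinite_set A -> dense (\bigcup_(n in A) F n)).

Definition pi_base (X : topologicalType) (B : set (set X)) : Prop :=
  (forall U, B U -> open U /\ U !=set0) /\
  (forall O : set X, open O -> O !=set0 -> exists2 U, B U & U `<=` O).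

Definition pi_weight_eq (X : topologicalType) (U : Type) (K : set U) : Prop :=
  least_card (@pi_base X) K.

(* Main.v *)
Require Import Defs.
From HB Require Import structures.
From mathcomp Require Import all_boot all_order.
From mathcomp Require Import boolp classical_sets functions cardinality filter.
From mathcomp Require Import topology.
From mathcomp Require wochoice.
From mathcomp Require Import zify.

Local Open Scope classical_set_scope.
Local Open Scope card_scope.

(** The space has underlying set [nat]. Its topology is generated by declaring
    sets clopen, one at a time, in a transfinite construction of length c that
    also accumulates commitments: pairs (s, x) where the sequence s has to
    converge to x in the final topology. A new set C is allowed when every
    previous commitment (s, x) satisfies C (s n) <-> C x eventually; a new
    commitment is allowed when it satisfies this for every previous set. At the
    start all residue classes modulo powers of 2 are declared clopen, which
    already gives a Hausdorff space with a clopen base. The set [nat] is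
    partitioned into 2-adically dense cells, indexed by a block p and a place q,
    and each point is committed to be the limit of a sequence from each cell, so
    that the cells remain dense. A bookkeeping over all pairs (A, x) and all
    sequences F of finite sets assigns one task to each stage. As b = c, there
    are fewer than b sets and commitments before each stage, so that functions
    in [nat -> nat] attached to each of them have a common bound for eventual
    domination ([small]).

    For the task (A, x): let A* be the set of limits, for the sets declared so
    far, of sequences in A. By domination a diagonal argument shows that A* is
    closed under the commitments ([limit_of_closed]). If x is in A*, commit a
    sequence of A to x. Otherwise [separation] provides an allowed set
    containing x and disjoint from A. This yields the Frechet-Urysohn property.

    [separation] is the heart of the argument. Given a set A closed under the
    commitments and x0 outside A, fix one g that eventually dominates, for each
    commitment (s, x), the largest value of s at 2-adic valuation m from x, as a
    function of m. Then C is the set of points reachable from x0 by links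
    x -> y, where y is outside A, y <= g (val2 x y), and y is 2-adically closer
    to x than all the numbers below x are. Each sequence committed to a point of
    C is eventually made of links, so it is eventually in C; and C is closed
    already in the 2-adic topology ([reach_closed]), as links increase and the
    successive targets lie in nested balls that avoid each given point from some
    index on.

    For the task F, commitments are kept [tame]: a committed sequence stays in
    one block, or leaves every block. If g dominates the places visited in each
    block by all the sequences of the second kind, the union A of the finite
    sets F (2 ^ p * 3 ^ g p), each cut down to the cell (p, g p), meets every
    committed sequence finitely often; so [separation] applies to A. The
    resulting open set shows that F is not a selection witnessing
    H-separability.

    Finally the pi-weight: in a countable space that is not H-separable, a
    pi-base B gives an unbounded family of functions, sending U in B and n to
    the index of a point of U in the n-th dense set; hence B has at least b = c
    elements ([pi_base_ge_continuum]). *)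

(** * Families of fewer than b indices *)

(** Every family of functions in [nat -> nat] indexed by [O] is dominated by a
    single one. This is what [O] having fewer than b elements provides, and,
    unlike a bound on the cardinality, it is directly seen to be stable under
    unions. *)
Definition small {V : Type} (O : set V) : Prop :=
  forall f : V -> nat -> nat,
    exists g, forall v, O v -> lt_mod_finite (f v) g.

Lemma small_lt_continuum (V : Type) (O : set V) :
  (forall B, unbounded B -> continuum #<= B) -> ~ (continuum #<= O) -> small O.
Proof.
move=> b_ge Olt f; apply: contrapT => f_unb; apply: Olt.
apply: card_le_trans (card_image_le f O); apply: b_ge => -[g gP].
by apply: f_unb; exists g => v Ov; apply: gP; exists v.
Qed.

Lemma smallU {V : Type} (O1 O2 : set V) :
  small O1 -> small O2 -> small (O1 `|` O2).
Proof.
move=> O1s O2s f; have [g1 g1P] := O1s f; have [g2 g2P] := O2s f.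
exists (fun n => maxn (g1 n) (g2 n)) => v [/g1P|/g2P]; rewrite /lt_mod_finite.
  by apply: filterS => n; rewrite leq_max => ->.
by apply: filterS => n; rewrite leq_max => ->; rewrite orbT.
Qed.

Lemma small_image {V W : Type} (h : V -> W) (O : set V) :
  small O -> small (h @` O).
Proof.
move=> Os f; have [g gP] := Os (f \o h).
by exists g => _ [v Ov <-]; exact: gP.
Qed.

Lemma small_inl {V W : Type} (O : set (V + W)) :
  small O -> small [set v | O (inl v)].
Proof.
move=> Os f; have [g gP] := Os (fun o => if o is inl v then f v else id).
by exists g => v /gP.
Qed.

Lemma small_inr {V W : Type} (O : set (V + W)) :
  small O -> small [set v | O (inr v)].
Proof.
move=> Os f; have [g gP] := Os (fun o => if o is inr v then f v else id).
by exists g => v /gP.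
Qed.

Lemma small_range {I : countType} {V : Type} (u : I -> V) : small (range u).
Proof.
move=> f.
pose h i n := if unpickle i is Some j then f (u j) n else 0.
exists (fun n => (\max_(i < n.+1) h i n).+1) => _ [j _ <-].
exists (pickle j) => // n /= le_jn.
have := @leq_bigmax _ (fun i : 'I_n.+1 => h i n) (Ordinal (le_jn : pickle j < n.+1)).
by rewrite /h /= pickleK ltnS.
Qed.

(** * The 2-adic valuation of a difference *)

(** The 2-adic valuation of a - b. For a = b the value is 0 instead of
    infinity, whence the hypotheses of distinctness below. *)
Definition val2 (a b : nat) : nat := logn 2 ((a - b) + (b - a)).

Lemma val2C a b : val2 a b = val2 b a.
Proof. by rewrite /val2 addnC. Qed.

Lemma val2_le a b : val2 a b <= (a - b) + (b - a).
Proof.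
rewrite /val2; case: (posnP (a - b + (b - a))) => [->|]; first by rewrite logn0.
by move=> /ltn_logl lt_log; exact: ltnW.
Qed.

Lemma leq_val2 a b k : a <> b -> (k <= val2 a b) = (a == b %[mod 2 ^ k]).
Proof.
move=> neq_ab; wlog lt_ab : a b neq_ab / a < b.
  move=> wl; case: (ltngtP a b) => [ab|ba|//]; first exact: wl.
  by rewrite val2C eq_sym; apply: wl ba; exact: nesym.
rewrite eq_sym (eqn_mod_dvd _ (ltnW lt_ab)) pfactor_dvdn ?subn_gt0// /val2.
by have -> : a - b + (b - a) = b - a by lia.
Qed.

Lemma val2_ultra a b c : a <> c -> b <> a -> b <> c ->
  minn (val2 a b) (val2 b c) <= val2 a c.
Proof.
move=> ac ba bc; have ab : a <> b by move=> /esym.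
rewrite leq_val2//; apply/eqP; transitivity (b %% 2 ^ minn (val2 a b) (val2 b c)).
  by apply/eqP; rewrite -leq_val2// geq_minl.
by apply/eqP; rewrite -leq_val2// geq_minr.
Qed.

(** * Separating a point from a set closed under the commitments *)

Section Reach.
Variables (A : set nat) (g : nat -> nat) (x0 : nat).

(** The inequalities on valuations say that [y] lies in a ball around [x] that
    contains no number below [x]; hence links are increasing. *)
Definition link (x y : nat) : Prop :=
  [/\ ~ A y, x <> y, y <= g (val2 x y) & forall w, w < x -> val2 x w < val2 x y].

(** The points at the end of a chain of links starting from [x0]. *)
Inductive reach : nat -> Prop :=
| reach_start : reach x0
| reach_link x y : reach x -> link x y -> reach y.

(** [y] is [z] or a number above [z] in the largest ball around [z] without
    numbers below [z]; every chain of links from [z] remains there. *)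
Definition below (z y : nat) : Prop :=
  y = z \/ (z < y /\ forall w, w < z -> val2 z w < val2 z y).

Lemma link_lt x y : link x y -> x < y.
Proof.
move=> [_ neq_xy _ far]; case: (ltngtP x y) => [//|/far|//].
by rewrite ltnn.
Qed.

Lemma below_link z x y : below z x -> link x y -> below z y.
Proof.
move=> zx xy; have lt_xy := link_lt _ _ xy.
case: xy => _ _ _ far; case: zx => [<-|[lt_zx zx]]; first by right.
right; split=> [|w wz]; first exact: ltn_trans lt_xy.
have := val2_ultra z x y; have := far z lt_zx; have := zx w wz.
rewrite (val2C x z); lia.
Qed.

(** Being smaller than [z], [y] is outside the ball that contains [z] and [e], so
    that [e] is no closer to [y] than [z] is. *)
Lemma below_val2 z e y : below z e -> y < z -> val2 e y <= val2 z y.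
Proof.
case=> [->//|[lt_ze ze]] lt_yz.
have := ze _ lt_yz; have := val2_ultra z e y; lia.
Qed.

(** The complement of the set of reachable points is open for the 2-adic
    topology. *)
Lemma reach_closed y : ~ reach y -> exists k, forall e, reach e -> val2 e y < k.
Proof.
move=> ny.
(* M bounds y, x0 and the targets of those links x -> z with x < y for which z
   and y have the same valuation from x. *)
pose M := maxn y (maxn x0 (\max_(e < y) g (val2 e y))).
exists (M + y).+1 => e re.
suff [w wM ew] : exists2 w, w <= M & val2 e y <= val2 w y.
  have := val2_le w y; lia.
(* Either e < y, or the first point above y in a chain from x0 to e is x0 itself
   or is some z linked from an x < y; e is then in the ball of that point. *)
have {re} [lt_ey|[[y0 xe]|[x [z [xy yz xz ze]]]]] : e < y \/
    (y < x0 /\ below x0 e) \/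
    exists x z, [/\ x < y, y < z, link x z & below z e].
- elim: re => [|x z rx IH xz].
    case: (ltngtP x0 y) => [|y0|x0y]; [by left|by right; left; split=> //; left|].
    by case: ny; rewrite -x0y; constructor.
  case: IH => [xy|[[y0 xe]|[x' [z' [x'y yz' x'z' z'x]]]]].
  + case: (ltngtP z y) => [|yz|zy]; first by left.
      by right; right; exists x, z; split=> //; left.
    by case: ny; rewrite -zy; apply: reach_link rx xz.
  + by right; left; split=> //; apply: below_link xz.
  + by right; right; exists x', z'; split=> //; apply: below_link xz.
- by exists e => //; rewrite /M; lia.
- by exists x0; [rewrite /M; lia|exact: below_val2 xe y0].
have ezy := below_val2 _ _ _ ze yz.
case: xz => _ _ zg _.
have [eq_v|neq_v] := eqVneq (val2 x z) (val2 x y).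
  exists z => //; rewrite !leq_max; apply/orP; right; apply/orP; right.
  rewrite (leq_trans zg)// eq_v.
  exact: (@leq_bigmax _ (fun i : 'I_y => g (val2 i y)) (Ordinal xy)).
exists x; first by rewrite /M; lia.
have := val2_ultra x y z; have := val2_ultra x z y.
rewrite (val2C y z); lia.
Qed.

End Reach.

(** The condition for [s] to converge to [x] once [C] is declared clopen. *)
Definition settles (C : set nat) (s : nat -> nat) (x : nat) : Prop :=
  \forall n \near \oo, C (s n) <-> C x.

(** For [S] the commitments so far and [A] closed under them, a point outside
    [A] has a neighbourhood disjoint from [A] that can be declared clopen. *)
Lemma separation (S : set ((nat -> nat) * nat)) (A : set nat) (x0 : nat) :
    small S ->
    (forall s x, S (s, x) ->
      forall k, \forall n \near \oo, s n == x %[mod 2 ^ k]) ->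
    (forall s x, S (s, x) -> ~ A x -> \forall n \near \oo, ~ A (s n)) ->
    ~ A x0 ->
  exists C : set nat, [/\ C x0, forall y, C y -> ~ A y &
    forall s x, S (s, x) -> settles C s x].
Proof.
move=> S_small S_cvg A_closed nAx0.
(* f (s, x) m bounds the values of s at valuation m from x. *)
have /choice[f fP] : forall v : (nat -> nat) * nat, exists h : nat -> nat,
    S v -> forall n, v.1 n <> v.2 -> v.1 n <= h (val2 v.2 (v.1 n)).
  move=> [s x] /=.
  have [Ssx|] := pselect (S (s, x)); last by exists id.
  suff /choice[h hP] : forall m, exists M, forall n, s n <> x ->
      val2 x (s n) = m -> s n <= M.
    by exists h => _ n snx; exact: hP.
  move=> m; have [N _ NP] := S_cvg _ _ Ssx m.+1.
  exists (\max_(i < N) s i) => n snx vm.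
  have [lt_nN|le_Nn] := ltnP n N; first exact: (leq_bigmax (Ordinal lt_nN)).
  have := NP n le_Nn; rewrite /= -leq_val2// val2C vm; lia.
have [g gP] := S_small f.
exists (reach A g x0); split.
- by constructor.
- by move=> y; case=> // ? ? _ [].
move=> s x Ssx; rewrite /settles.
have [rx|nrx] := pselect (reach A g x0 x).
  have nAx : ~ A x by case: rx => // ? ? _ [].
  have [N _ NP] := gP _ Ssx.
  near=> n; split=> // _.
  have [->//|/eqP snx] := eqVneq (s n) x.
  have : (N + x).+1 <= val2 x (s n).
    by rewrite val2C leq_val2//; near: n; exact: S_cvg.
  move=> far; apply: (reach_link _ _ _ _ _ rx); split=> //.
  - by near: n; exact: A_closed Ssx nAx.
  - exact: nesym.
  - apply/ltnW/(leq_ltn_trans (fP _ Ssx n snx)); apply: NP => /=; lia.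
  - move=> w wx; have := val2_le x w; lia.
have [k kP] := reach_closed _ _ _ _ nrx.
near=> n; split=> // rsn.
have snx : s n <> x by move=> snx; apply: nrx; rewrite -snx.
have : k <= val2 (s n) x by rewrite leq_val2//; near: n; exact: S_cvg.
by have := kP _ rsn; lia.
Unshelve. all: by end_near. Qed.

(** * Dense cells and the sequences approaching a point within a cell *)

(** The block and the place of [x] are the exponents of 2 and 3 in the position
    of the leading binary digit of [x]. *)
Definition block (x : nat) : nat := logn 2 (trunc_log 2 x).
Definition place (x : nat) : nat := logn 3 (trunc_log 2 x).
Definition cell (p q : nat) : set nat := [set x | block x = p /\ place x = q].

(** Adding a power of 2 larger than [x] puts the leading digit at a position with
    prescribed exponents of 2 and 3, while the lower digits are those of [x]. *)
Definition approach (x p q t : nat) : nat := x + 2 ^ (2 ^ p * 3 ^ q * 5 ^ (t + x)).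

Lemma logn_cell p q : logn 2 (2 ^ p * 3 ^ q) = p /\ logn 3 (2 ^ p * 3 ^ q) = q.
Proof.
rewrite !lognM ?expn_gt0// !lognX !logn_prime//=; lia.
Qed.

Lemma approach_level_gt x p q t : t + x < 2 ^ p * 3 ^ q * 5 ^ (t + x).
Proof.
have : t + x < 5 ^ (t + x) by exact: ltn_expl.
have : 0 < 2 ^ p * 3 ^ q by rewrite muln_gt0 !expn_gt0.
by nia.
Qed.

Lemma approach_cell x p q t : cell p q (approach x p q t).
Proof.
rewrite /cell /block /place /= (_ : trunc_log 2 _ = 2 ^ p * 3 ^ q * 5 ^ (t + x)).
  by rewrite !lognM ?muln_gt0 ?expn_gt0// !lognX !logn_prime//=; lia.
apply: trunc_log_eq => //; rewrite leq_addl expnS mul2n -addnn ltn_add2r.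
apply: leq_trans (ltn_expl _ (isT : 1 < 2)) _.
by rewrite leq_pexp2l//; have := approach_level_gt x p q t; lia.
Qed.

Lemma approach_neq x p q t : approach x p q t <> x.
Proof.
rewrite /approach; have : 0 < 2 ^ (2 ^ p * 3 ^ q * 5 ^ (t + x)) by rewrite expn_gt0.
lia.
Qed.

Lemma approach_cvg x p q k :
  \forall t \near \oo, approach x p q t == x %[mod 2 ^ k].
Proof.
exists k => // t /= le_kt; rewrite /approach -modnDmr.
have /eqP -> : 2 ^ k %| 2 ^ (2 ^ p * 3 ^ q * 5 ^ (t + x)).
  by apply: dvdn_exp2l; have := approach_level_gt x p q t; lia.
by rewrite addn0.
Qed.

(** * Tasks and one step of the construction *)

(** A sequence within a single block, or leaving every block. *)
Definition tame (s : nat -> nat) : Prop :=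
  (exists p, forall n, block (s n) = p) \/
  (forall p, \forall n \near \oo, block (s n) <> p).

Lemma often_subseq (E : set nat) : ~ (\forall n \near \oo, ~ E n) ->
  exists2 phi : nat -> nat, forall n, n <= phi n & forall n, E (phi n).
Proof.
move=> nE; suff /choice[phi phiP] : forall n, exists m, n <= m /\ E m.
  by exists phi => n; case: (phiP n).
move=> n; apply: contrapT => no; apply: nE; exists n => // m /= nm Em.
by apply: no; exists m.
Qed.

Lemma tame_subseq (s : nat -> nat) :
  exists2 phi : nat -> nat, forall n, n <= phi n & tame (s \o phi).
Proof.
have [sP|] := pselect (forall p, \forall n \near \oo, block (s n) <> p).
  by exists id => //; right.
move=> /existsNP[p /often_subseq[phi phi_ge phiP]].
by exists phi => //; left; exists p.
Qed.

Lemma near_subseq (phi : nat -> nat) (E : set nat) : (forall n, n <= phi n) ->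
  (\forall n \near \oo, E n) -> \forall n \near \oo, E (phi n).
Proof.
move=> phi_ge [N _ NE]; exists N => // n /= Nn; apply: NE.
exact: leq_trans Nn (phi_ge n).
Qed.

(** The result of a stage: [inl (s, x)] commits [s] to converge to [x] and
    [inr C] declares [C] clopen. *)
Definition outcome : Type := ((nat -> nat) * nat) + set nat.

(** [inl (A, x)] asks to decide whether [x] is in the closure of [A], and
    [inr F] to prevent [F] from witnessing H-separability. *)
Definition task : Type := (set nat * nat) + (nat -> set nat).

(** The class of [a] modulo [2 ^ k]. *)
Definition residue (a k : nat) : set nat := [set y | y == a %[mod 2 ^ k]].

(** The outcome [o] is compatible with all those in [O]. The condition
    [s n <> x] ensures that [s] leaves every finite set. *)
Definition admissible (O : set outcome) (o : outcome) : Prop :=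
  match o with
  | inl (s, x) => [/\ tame s, forall n, s n <> x &
      forall C, O (inr C) -> settles C s x]
  | inr C => forall s x, O (inl (s, x)) -> settles C s x
  end.

(** The outcomes in [O] are pairwise compatible and include all residue classes,
    so that committed sequences converge 2-adically. *)
Definition coherent (O : set outcome) : Prop :=
  (forall a k, O (inr (residue a k))) /\ (forall o, O o -> admissible O o).

(** For a task [inr F], the points of [F (2 ^ p * 3 ^ g p)] are only considered
    within the cell (p, g p), which contains that set when [F n] is a subset of
    the [n]-th cell for the numbering of cells by exponents of 2 and 3. *)
Definition solves (T : task) (o : outcome) : Prop :=
  match T, o with
  | inl (A, x), inl (s, y) => y = x /\ forall n, A (s n)
  | inl (A, x), inr C => A x \/ (C x /\ forall y, C y -> ~ A y)
  | inr F, inl _ => False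
  | inr F, inr C => (forall n, finite_set (F n)) ->
      C !=set0 /\ exists g : nat -> nat,
        forall p y, cell p (g p) y -> F (2 ^ p * 3 ^ g p) y -> ~ C y
  end.

Lemma coherent_cvg O s x : coherent O -> O (inl (s, x)) ->
  forall k, \forall n \near \oo, s n == x %[mod 2 ^ k].
Proof.
move=> [Ores Oadm] Osx k; have [_ _ /(_ _ (Ores x k))] := Oadm _ Osx.
by apply: filterS => n [_]; apply; rewrite /residue /=.
Qed.

Lemma coherent_escape O s x : coherent O -> O (inl (s, x)) ->
  forall y, \forall n \near \oo, s n <> y.
Proof.
move=> Oco Osx y; have [_ sx _] := Oco.2 _ Osx.
have [->|neq_yx] := pselect (y = x); first exact: nearW.
apply: filterS (coherent_cvg _ _ _ Oco Osx (val2 y x).+1) => n + sny.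
by rewrite sny -leq_val2// ltnn.
Qed.

(** The limits of the sequences in [A] for the clopen sets declared in [O]. *)
Definition limit_of (O : set outcome) (A : set nat) : set nat :=
  [set y | exists2 r : nat -> nat, forall n, A (r n) &
     forall C, O (inr C) -> settles C r y].

(** If [s] converges to [x] and each [s n] is the limit of a sequence [r n] in
    [A], a single [g] such that the diagonal [r n (g n)] converges to [x] exists
    because the sets in [O] are few. *)
Lemma limit_of_closed O A s x : small O -> coherent O -> O (inl (s, x)) ->
  ~ limit_of O A x -> \forall n \near \oo, ~ limit_of O A (s n).
Proof.
move=> Os Oco Osx; apply: contra_notP => /often_subseq[phi phi_ge phiP].
have /choice[r rP] : forall n, exists r : nat -> nat, (forall i, A (r i)) /\
    forall C, O (inr C) -> settles C r (s (phi n)).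
  by move=> n; have [r] := phiP n; exists r.
have /choice[f fP] : forall C : set nat, exists h : nat -> nat, O (inr C) ->
    forall n i, h n <= i -> C (r n i) <-> C (s (phi n)).
  move=> C; have [OC|] := pselect (O (inr C)); last by exists id.
  suff /choice[h hP] : forall n, exists M, forall i, M <= i ->
      C (r n i) <-> C (s (phi n)).
    by exists h => _ n i; exact: hP.
  by move=> n; have [M _ MP] := (rP n).2 C OC; exists M.
have [g gP] := small_inr _ Os f.
exists (fun n => r n (g n)) => [n|C OC]; first exact: (rP n).1.
have [_ _ /(_ _ OC)] := Oco.2 _ Osx.
move=> /(near_subseq _ _ phi_ge); apply: filterS2 (gP C OC) => n fg <-.
by apply: fP => //; exact: ltnW.
Qed.

Lemma task_limit O A x : small O -> coherent O ->
  exists2 o, admissible O o & solves (inl (A, x)) o.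
Proof.
move=> Os Oco; have [Ax|nAx] := pselect (A x).
  by exists (inr setT); [move=> s y _; exact: nearW|left].
have [[r rA rx]|nx] := pselect (limit_of O A x).
  have [phi phi_ge phi_tame] := tame_subseq r.
  exists (inl (r \o phi, x)); last by split=> // n /=.
  split=> //= [n rnx|C OC]; first by apply: nAx; rewrite -rnx.
  exact: near_subseq phi_ge (rx C OC).
have [C [Cx CA Cadm]] := separation _ (limit_of O A) x (small_inl _ Os)
  (fun s y => coherent_cvg _ s y Oco) (fun s y => limit_of_closed _ _ s y Os Oco) nx.
exists (inr C); [exact: Cadm|right; split=> // y /CA ny Ay; apply: ny].
by exists (fun=> y) => // D _; exact: nearW.
Qed.

Lemma escape_ge (u : nat -> nat) :
  (forall y, \forall n \near \oo, u n <> y) ->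
  forall M, \forall n \near \oo, M <= u n.
Proof.
move=> uP; elim=> [|M IH]; first exact: nearW.
apply: filterS2 IH (uP M) => n; lia.
Qed.

Lemma finite_nat_bounded (F : set nat) : finite_set F ->
  exists M, forall y, F y -> y < M.
Proof.
move=> /finite_seqP[l ->]; exists (\max_(i <- l) i).+1 => y /= yl.
by rewrite ltnS (big_rem y yl) /= leq_maxl.
Qed.

Lemma task_selection O (F : nat -> set nat) : small O -> coherent O ->
  exists2 o, admissible O o & solves (inr F) o.
Proof.
move=> Os Oco; have [Ffin|nF] := pselect (forall n, finite_set (F n)); last first.
  by exists (inr setT) => //; move=> s y _; exact: nearW.
(* f (s, x) p bounds the places visited by s in a block p that it leaves. *)
have /choice[f fP] : forall v : (nat -> nat) * nat, exists h : nat -> nat,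
    forall p, (\forall n \near \oo, block (v.1 n) <> p) ->
    forall n, block (v.1 n) = p -> place (v.1 n) <= h p.
  move=> [s x] /=; suff /choice[h hP] : forall p, exists M,
      (\forall n \near \oo, block (s n) <> p) ->
      forall n, block (s n) = p -> place (s n) <= M by exists h.
  move=> p; have [[N _ NP]|] := pselect (\forall n \near \oo, block (s n) <> p);
    last by exists 0.
  exists (\max_(i < N) place (s i)) => _ n snp.
  have [lt_nN|/NP//] := ltnP n N.
  exact: (leq_bigmax (Ordinal lt_nN)).
have [g gP] := small_inl _ Os f.
pose A := [set y | F (2 ^ block y * 3 ^ g (block y)) y /\ place y = g (block y)].
(* A point of block 0 with a place other than g 0 is outside A. *)
pose x0 := approach 0 0 (g 0).+1 0.
have nAx0 : ~ A x0.
  have [b0 p0] := approach_cell 0 0 (g 0).+1 0.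
  by move=> [_]; rewrite p0 b0; lia.
have A_closed s x : O (inl (s, x)) -> ~ A x -> \forall n \near \oo, ~ A (s n).
  move=> Osx _; have [[[p sp]|s_esc] sx _] := Oco.2 _ Osx.
    have [M MP] := finite_nat_bounded _ (Ffin (2 ^ p * 3 ^ g p)).
    apply: filterS (escape_ge _ (coherent_escape _ _ _ Oco Osx) M) => n Msn [].
    by rewrite sp => /MP; lia.
  have [N _ NP] := gP _ Osx.
  apply: filterS (escape_ge _ s_esc N) => n /NP /= fg [_ plg].
  have := fP (s, x) _ (s_esc (block (s n))) n erefl.
  by rewrite /= plg; lia.
have [C [Cx0 CA Cadm]] := separation _ A x0 (small_inl _ Os)
  (fun s y => coherent_cvg _ s y Oco) A_closed nAx0.
exists (inr C); first exact: Cadm.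
move=> _; split; first by exists x0.
by exists g => p y [<- yg] Fy /CA; apply; split.
Qed.

Lemma task_solvable O T : small O -> coherent O ->
  exists o, admissible O o /\ solves T o.
Proof.
move=> Os Oco; case: T => [[A x]|F].
  by have [o] := task_limit _ A x Os Oco; exists o.
by have [o] := task_selection _ F Os Oco; exists o.
Qed.

(** * The transfinite construction *)

Lemma wf_total_order (U : Type) : exists lt : U -> U -> Prop,
  [/\ well_founded lt, forall x y z, lt x y -> lt y z -> lt x z
    & forall x y, [\/ x = y, lt x y | lt y x]].
Proof.
have [R Rwo] := wochoice.well_ordering_principle {classic U}.
have min (E : set U) : E !=set0 ->
    exists z, E z /\ forall y, E y -> R z y.
  move=> [x Ex]; have [|z [[Ez Rz] _]] := Rwo (mem E).
    by exists x; rewrite inE.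
  exists z; split=> [|y Ey]; first by move: Ez; rewrite inE.
  by apply: Rz; rewrite inE.
have tot x y : R x y \/ R y x.
  have [|z [[->|->] zP]] := min [set x; y]; first by exists x; left.
    by left; apply: zP; right.
  by right; apply: zP; left.
have anti x y : R x y -> R y x -> x = y.
  move=> xy yx; have [|z [[zE _] zU]] := Rwo (mem [set x; y]).
    by exists x; rewrite inE; left.
  have Rxx : R x x by case: (tot x x).
  have Ryy : R y y by case: (tot y y).
  have <- : z = x.
    by apply: zU; split=> [|w]; rewrite inE; [left|case=> ->].
  by apply: zU; split=> [|w]; rewrite inE; [right|case=> ->].
exists (fun x y => R x y /\ x <> y); split.
- move=> x; apply: contrapT => nx.
  have [|z [nz zP]] := min [set y | ~ Acc (fun x y => R x y /\ x <> y) y].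
    by exists x.
  apply: nz; constructor=> y [yz neq_yz]; apply: contrapT => ny.
  by apply: neq_yz; apply: anti yz (zP y ny).
- move=> x y z [xy nxy] [yz nyz]; split; last first.
    by move=> xz; apply: nxy; apply: anti xy _; rewrite xz.
  have [|w [[[->|->]|->] wP]] := min [set x; y; z]; first by exists x; left; left.
  + by apply: wP; right.
  + by case: nxy; apply: anti xy _; apply: wP; left; left.
  + by case: nyz; apply: anti yz _; apply: wP; left; right.
- move=> x y; have [->|nxy] := pselect (x = y); first exact: Or31.
  by have [xy|yx] := tot x y; [exact: Or32|apply: Or33; split=> //; exact: nesym].
Qed.

(** A set [T] of cardinality at least that of [K] with a well-order whose proper
    initial segments are smaller than [K]: the whole type, or the first initial
    segment that is not smaller than [K]. *)
Lemma short_enumeration (U : Type) (K : set U) :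
  exists (lt : U -> U -> Prop) (T : set U),
   [/\ well_founded lt, forall x y, [\/ x = y, lt x y | lt y x],
       forall s t, T t -> lt s t -> T s,
       forall t, T t -> ~ (K #<= [set s | lt s t]) & K #<= T].
Proof.
have [lt [lt_wf lt_tr lt_tot]] := wf_total_order U.
exists lt; have [big|nbig] := pselect (exists t, K #<= [set s | lt s t]); last first.
  exists setT; split=> // [t _ tK|]; last exact: card_leT.
  by apply: nbig; exists t.
suff [t0 t0K t0min] : exists2 t0, K #<= [set s | lt s t0] &
    forall t, lt t t0 -> ~ (K #<= [set s | lt s t]).
  by exists [set s | lt s t0]; split=> // s t tt0 st; exact: lt_tr st tt0.
case: big => t; elim/(well_founded_ind lt_wf): t => t IH tK.
have [[s [st sK]]|no] := pselect (exists s, lt s t /\ K #<= [set r | lt r s]).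
  exact: IH sK.
by exists t => // s st sK; apply: no; exists s.
Qed.

(** Tasks are coded by subsets of a countable type; the first component of [c] is
    a tag, distinguishing the two kinds of tasks and their parts. *)
Definition task_code (T : task) (c : nat * nat * nat) : Prop :=
  match T, c with
  | inl (A, x), (0, _, i) => A i
  | inl (A, x), (1, _, i) => i = x
  | inl _, _ => False
  | inr F, (0, _, _) => False
  | inr F, (1, _, _) => False
  | inr F, (2, _, _) => True
  | inr F, (_, n, i) => F n i
  end.

Lemma task_code_inj : injective task_code.
Proof.
move=> T T' eq_TT'; have {}eq_TT' c : task_code T c = task_code T' c by rewrite eq_TT'.
case: T eq_TT' => [[A x]|F]; case: T' => [[A' x']|F'] eq_TT'.
- have -> : A = A' by apply/funext => i; exact: (eq_TT' (0, 0, i)).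
  by have /= <- : task_code (inl (A', x')) (1, 0, x) by rewrite -eq_TT'.
- by have [] : task_code (inl (A, x)) (2, 0, 0) by rewrite eq_TT'.
- by have [] : task_code (inl (A', x')) (2, 0, 0) by rewrite -eq_TT'.
- by congr inr; apply/funext => n; apply/funext => i; exact: (eq_TT' (3, n, i)).
Qed.

Lemma task_enumeration (T : set (set nat)) : continuum #<= T ->
  exists dec : set nat -> task, forall k, exists2 t, T t & dec t = k.
Proof.
move=> /pcard_leP[f].
pose code (k : task) : set nat := [set n | exists2 c, n = pickle c & task_code k c].
have code_inj : injective code.
  move=> k k' eq_kk'; apply: task_code_inj; apply/funext => c; apply/propext.
  have pin h : task_code h c <-> code h (pickle c).
    by split=> [hc|[c' /(pcan_inj pickleK) <-]]; first by exists c.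
  by rewrite !pin eq_kk'.
have fcode_inj : injective (f \o code).
  by move=> k k' /= /(@inj _ _ _ f) eq_c; apply: code_inj; apply: eq_c; rewrite inE.
have /choice[dec decP] : forall t, exists k, forall k', f (code k') = t -> k = k'.
  move=> t; have [[k kt]|no] := pselect (exists k, f (code k) = t).
    by exists k => k' k't; apply: fcode_inj; rewrite /= kt k't.
  by exists (inr (fun=> set0)) => k' k't; case: no; exists k'.
exists dec => k; exists (f (code k)); first exact: funS.
exact: decP.
Qed.

(** The residue classes, and the commitments which make every cell dense. *)
Definition initial_outcomes : set outcome :=
  range (fun ak : nat * nat => inr (residue ak.1 ak.2)) `|`
  range (fun v : nat * nat * nat => inl (approach v.1.1 v.1.2 v.2, v.1.1)).

Lemma small_initial_outcomes : small initial_outcomes.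
Proof. by apply: smallU; exact: small_range. Qed.

(** The initial outcomes together with those of the stages in [E]. *)
Definition upto (o : set nat -> outcome) (E : set (set nat)) : set outcome :=
  initial_outcomes `|` o @` E.

Lemma residue_settles s x a k :
  (forall k, \forall n \near \oo, s n == x %[mod 2 ^ k]) ->
  settles (residue a k) s x.
Proof.
move=> /(_ k); apply: filterS => n /eqP sx.
by rewrite /residue /= sx.
Qed.

Lemma admissible_initial_outcomes o : initial_outcomes o -> admissible initial_outcomes o.
Proof.
have res s x C :
    initial_outcomes (inl (s, x)) -> initial_outcomes (inr C) -> settles C s x.
  move=> [[]//|[[[y p] q] _ /= [<- <-]]] [[[a k] _ [<-]]|[]//].
  by apply: residue_settles => k'; exact: approach_cvg.
case: o => [[s x]|C] bo /=; last by move=> s x bs; exact: res.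
split=> [||C]; last exact: res.
- left; case: bo => [[]//|[[[y p] q] _ /= [<- _]]].
  by exists p => n; have [] := approach_cell y p q n.
- by case: bo => [[]//|[[[y p] q] _ /= [<- <-]]] n; exact: approach_neq.
Qed.

Lemma coherent_upto (lt : set nat -> set nat -> Prop) (o : set nat -> outcome)
    (E : set (set nat)) :
  (forall x y, [\/ x = y, lt x y | lt y x]) ->
  (forall t, E t -> admissible (upto o [set s | lt s t]) (o t)) ->
  coherent (upto o E).
Proof.
move=> lt_tot oP; have bub F : initial_outcomes `<=` upto o F by move=> ?; left.
have all_settle s x C : upto o E (inl (s, x)) -> upto o E (inr C) -> settles C s x.
  move=> [bs|[t Et ot]] [bC|[t' Et' ot']].
  - by have [_ _] := admissible_initial_outcomes _ bs; apply.
  - by have := oP _ Et'; rewrite ot'; apply; left.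
  - by have := oP _ Et; rewrite ot => -[_ _]; apply; left.
  - have [tt'|tt'|t't] := lt_tot t t'; first by move: ot'; rewrite -tt' ot.
    + by have := oP _ Et'; rewrite ot'; apply; right; exists t.
    + by have := oP _ Et; rewrite ot => -[_ _]; apply; right; exists t'.
split=> [a k|]; first by left; left; exists (a, k).
case=> [[s x]|C] Eo /=; last by move=> s x Es; exact: all_settle.
have [ts sx] : tame s /\ forall n, s n <> x.
  case: Eo => [/admissible_initial_outcomes[]//|[t Et ot]].
  by have := oP _ Et; rewrite ot => -[].
by split=> // C EC; exact: all_settle.
Qed.

(** The final collection of sets and commitments, in which every task has been
    solved. *)
Lemma exists_outcomes : (forall B, unbounded B -> continuum #<= B) ->
  exists O : set outcome, [/\ coherent O, initial_outcomes `<=` O &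
    forall T, exists2 o, O o & solves T o].
Proof.
move=> b_ge.
have [lt [T [lt_wf lt_tot T_down T_small T_big]]] :=
  short_enumeration (set nat) continuum.
have [dec decP] := task_enumeration T T_big.
(* pick (O, k) is an outcome admissible for O that solves k. *)
have /choice[pick pickP] : forall Ot : set outcome * task, exists o,
    small Ot.1 -> coherent Ot.1 -> admissible Ot.1 o /\ solves Ot.2 o.
  move=> [O k] /=; have [Os|] := pselect (small O); last by exists (inr setT).
  have [Oc|] := pselect (coherent O); last by exists (inr setT).
  by have [o] := task_solvable O k Os Oc; exists o.
pose step t (rec : forall s, lt s t -> outcome) : outcome :=
  pick (initial_outcomes `|` [set v | exists s (h : lt s t), rec s h = v], dec t).
pose o := Fix lt_wf (fun=> outcome) step.
have oE t : o t = pick (upto o [set s | lt s t], dec t).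
  rewrite /o Fix_eq => [|x f g fg]; last first.
    by congr step; apply/functional_extensionality_dep => s; apply/funext.
  rewrite /step /upto; congr (pick (initial_outcomes `|` _, _)).
  by apply/seteqP; split=> v /= [s] => [[h <-]|h <-]; exists s.
have seg_small t : T t -> small (upto o [set s | lt s t]).
  move=> Tt; apply: smallU small_initial_outcomes _; apply: small_image.
  exact: small_lt_continuum b_ge (T_small t Tt).
have oP t : T t -> admissible (upto o [set s | lt s t]) (o t) /\ solves (dec t) (o t).
  elim/(well_founded_ind lt_wf): t => t IH Tt; rewrite oE.
  apply: pickP; first exact: seg_small.
  apply: (coherent_upto _ _ _ lt_tot) => s /= st.
  by have [] := IH s st (T_down _ _ Tt st).
exists (upto o T); split.
- by apply: (coherent_upto _ _ _ lt_tot) => t /oP[].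
- by move=> ?; left.
- move=> k; have [t Tt <-] := decP k.
  by exists (o t); [right; exists t|have [] := oP t Tt].
Qed.

(** * The pi-weight of countable spaces that are not H-separable *)

Lemma infinite_nat_ge (A : set nat) (N : nat) : infinite_set A ->
  exists2 n, A n & N <= n.
Proof.
move=> Ainf; apply: contrapT => no; apply: Ainf.
apply: (sub_finite_set _ (finite_II N)) => n An /=.
by rewrite ltnNge; apply/negP => Nn; apply: no; exists n.
Qed.

Lemma pi_base_ge_continuum (X : topologicalType) (B : set (set X)) :
    (forall E, unbounded E -> continuum #<= E) ->
    countable [set: X] -> ~ H_separable X -> pi_base B ->
  continuum #<= B.
Proof.
move=> b_ge /countable_injP[e e_inj] nH [B_open B_pi].
apply: contrapT => /(small_lt_continuum _ _ b_ge) B_small; apply: nH => D D_dense.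
have /choice[f fP] : forall U : set X, exists h : nat -> nat, B U ->
    forall n, exists x, [/\ D n x, U x & e x = h n].
  move=> U; have [/B_open[oU U0]|] := pselect (B U); last by exists id.
  suff /choice[h hP] : forall n, exists k, exists x, [/\ D n x, U x & e x = k].
    by exists h.
  by move=> n; have [x [Ux Dx]] := D_dense n U U0 oU; exists (e x), x.
(* A g dominating all f U would select finite sets F n that meet every U in B
   for all but finitely many n. *)
have [g gP] := B_small f.
exists (fun n => D n `&` [set x | e x < g n]); split=> [n|A Ainf O O0 oO].
  split=> [|x []//]; apply: (@sub_finite_set _ _ (e @^-1` `I_(g n))) => [x []//|].
  apply: finite_preimage (finite_II _) => x y _ _; apply: e_inj; exact: in_setT.
have [U BU UO] := B_pi O oO O0.
have [N _ NP] := gP _ BU.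
have [n An Nn] := infinite_nat_ge A N Ainf.
have [x [Dx Ux ex]] := fP U BU n.
exists x; split; first exact: UO.
by exists n => //; split=> //=; rewrite ex; exact: NP.
Qed.

Lemma pi_weight_continuum (X : topologicalType) :
    (forall E, unbounded E -> continuum #<= E) ->
    countable [set: X] -> ~ H_separable X -> pi_weight_eq X continuum.
Proof.
move=> b_ge X_count nH; split; last by move=> B; exact: pi_base_ge_continuum.
(* In a countable space there are at most continuum many open sets. *)
pose B : set (set X) := [set U | open U /\ U !=set0].
have B_pi : pi_base B by split=> // O oO O0; exists O.
exists B => //; rewrite card_eq_le (pi_base_ge_continuum _ _ b_ge)// andbT.
have /countable_injP[e e_inj] := X_count.
apply: card_le_trans (card_image_le (fun V => e @^-1` V) continuum).
apply: subset_card_le => U _; exists (e @` U) => //.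
apply/seteqP; split=> x /=; last by exists x.
by move=> [y Uy /e_inj <-//]; exact: in_setT.
Qed.

(** * The topology in which given sets are clopen *)

(** The set [nat] with the coarsest topology in which all members of [S] are
    clopen. *)
Definition gen_space (S : set (set nat)) : Type := nat.

Definition gen_open (S : set (set nat)) : set (set nat) :=
  [set U | forall x, U x -> exists2 l : seq (set nat),
     forall C, C \in l -> S C &
     forall y, (forall C, C \in l -> C y <-> C x) -> U y].

Section GenSpace.
Variable S : set (set nat).

Let gen_openT : gen_open S setT.
Proof. by move=> x _; exists [::]. Qed.

Let gen_openI : setI_closed (gen_open S).
Proof.
move=> U V oU oV x [/oU[l1 l1S l1U] /oV[l2 l2S l2V]]; exists (l1 ++ l2).
  by move=> C; rewrite mem_cat => /orP[/l1S|/l2S].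
move=> y ly; split; [apply: l1U|apply: l2V] => C Cl; apply: ly.
  by rewrite mem_cat Cl.
by rewrite mem_cat Cl orbT.
Qed.

Let gen_open_bigU (I : Type) (f : I -> set nat) :
  (forall i, gen_open S (f i)) -> gen_open S (\bigcup_i f i).
Proof.
move=> fo x [i _ /fo[l lS lf]]; exists l => // y ly; exists i => //.
exact: lf.
Qed.

HB.instance Definition _ := Choice.copy (gen_space S) nat.
HB.instance Definition _ :=
  isOpenTopological.Build (gen_space S) gen_openT gen_openI gen_open_bigU.

Lemma gen_openE (U : set (gen_space S)) : open U <-> gen_open S U.
Proof. by []. Qed.

(** The basic clopen neighbourhood of [x] determined by the sets in [l]. *)
Definition agree (l : seq (set nat)) (x : nat) : set (gen_space S) :=
  [set y | forall C, C \in l -> C y <-> C x].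

Lemma agree_clopen l x : (forall C, C \in l -> S C) -> clopen (agree l x).
Proof.
move=> lS; split; [|rewrite -openC]; apply/gen_openE => y yx; exists l => //.
  by move=> z zy C Cl; rewrite zy// yx.
by move=> z zy zx; apply: yx => C Cl; rewrite -zy// zx.
Qed.

Lemma gen_clopen C : S C -> clopen (C : set (gen_space S)).
Proof.
move=> SC; split; [|rewrite -openC]; apply/gen_openE => y yC; exists [:: C].
- by move=> D; rewrite inE => /eqP ->.
- by move=> z /(_ C); rewrite inE eqxx => /(_ isT) ->.
- by move=> D; rewrite inE => /eqP ->.
- by move=> z /(_ C); rewrite inE eqxx => /(_ isT) zC /zC.
Qed.

Lemma nbhs_agree (x : gen_space S) (V : set (gen_space S)) : nbhs x V ->
  exists2 l, forall C, C \in l -> S C & agree l x `<=` V.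
Proof.
rewrite nbhsE => -[U [/gen_openE oU Ux] UV].
by have [l lS lU] := oU x Ux; exists l => // y ly; apply: UV; exact: lU.
Qed.

Lemma gen_has_clopen_base : has_clopen_base (gen_space S).
Proof.
exists clopen => //; split=> [U []//|x V /nbhs_agree[l lS lV]].
exists (agree l x) => //; split; last by [].
exact: agree_clopen.
Qed.

Lemma gen_hausdorff :
    (forall x y, x <> y -> exists2 C, S C & C x /\ ~ C y) ->
  hausdorff_space (gen_space S).
Proof.
move=> sep x y xy; apply: contrapT => /sep[C /gen_clopen[oC cC] [Cx nCy]].
have nC : nbhs y (~` C : set (gen_space S)).
  by apply: open_nbhs_nbhs; split=> //; rewrite openC.
have [z [Cz nCz]] := xy C _ (open_nbhs_nbhs (conj oC Cx)) nC.
exact: nCz.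
Qed.

Lemma gen_cvg (s : nat -> gen_space S) (x : gen_space S) :
  (forall C, S C -> settles C s x) -> s @ \oo --> x.
Proof.
move=> sS V /nbhs_agree[l lS lV]; apply: filterS lV _.
change (\forall n \near \oo, agree l x (s n)).
elim: l lS => [|C l IH] lS; first by apply: nearW.
have Cs := sS C (lS C (mem_head _ _)).
have lS' D : D \in l -> S D by move=> Dl; apply: lS; rewrite inE Dl orbT.
apply: filterS2 Cs (IH lS') => n Cn ln D.
by rewrite inE => /predU1P[->//|Dl]; exact: ln.
Qed.

End GenSpace.

(** * The space *)

Theorem theorem2 (b_eq_c : bounding_number_eq continuum) :
  exists X : topologicalType,
    countable [set: X] /\
    hausdorff_space X /\
    has_clopen_base X /\
    frechet_urysohn X /\
    ~ H_separable X /\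
    pi_weight_eq X continuum.
Proof.
have b_ge := b_eq_c.2.
have [O [[O_res O_adm] O_base O_solves]] := exists_outcomes b_ge.
pose S : set (set nat) := [set C | O (inr C)].
have O_cvg s x : O (inl (s, x)) -> (s : nat -> gen_space S) @ \oo --> (x : gen_space S).
  by move=> /O_adm[_ _ sS]; exact: gen_cvg.
have X_count : countable [set: gen_space S] by exact: (@countableP nat).
have X_sep : forall x y, x <> y -> exists2 C, S C & C x /\ ~ C y.
  move=> x y xy; exists (residue x (val2 y x).+1); first exact: O_res.
  split; first by rewrite /residue /=.
  by rewrite /residue /= -leq_val2 ?ltnn//; exact: nesym.
have nH : ~ H_separable (gen_space S).
  move=> /(_ (fun n => cell (logn 2 n) (logn 3 n)))[].
    move=> n U [x Ux] oU.
    have /O_cvg s_cvg : O (inl (approach x (logn 2 n) (logn 3 n), x)).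
      by apply: O_base; right; exists (x, logn 2 n, logn 3 n).
    have [N _ NU] := s_cvg U (open_nbhs_nbhs (conj oU Ux)).
    exists (approach x (logn 2 n) (logn 3 n) N); split; last exact: approach_cell.
    exact: NU N (leqnn N).
  move=> F [F_sub F_dense].
  have [[//|C] OC] := O_solves (inr F).
  move=> /= [n|C0 [g gP]]; first by have [] := F_sub n.
  have A_inf : infinite_set [set 2 ^ p * 3 ^ g p | p in setT].
    move=> /finite_nat_bounded[M MP].
    have : 2 ^ M * 3 ^ g M < M by apply: MP; exists M.
    have := ltn_expl M (isT : 1 < 2).
    have : 0 < 3 ^ g M by rewrite expn_gt0.
    nia.
  have [oC _] := gen_clopen S C OC.
  have [y [Cy [_ [p _ <-] Fy]]] := F_dense _ A_inf C C0 oC.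
  apply: (gP p y _ Fy) => //.
  by have /= := (F_sub _).2 _ Fy; have [-> ->] := logn_cell p (g p).
exists (gen_space S); split=> //; split; first exact: gen_hausdorff.
split; first exact: gen_has_clopen_base.
split; last by split=> //; exact: pi_weight_continuum.
move=> A x [Ax nAx].
have [o] := O_solves (inl (A, x)).
case: o => [[s y] /O_cvg s_cvg /= [<- sA]|C OC /= [//|[Cx CA]]]; first by exists s.
have [oC _] := gen_clopen S C OC.
have [z [Az Cz]] := Ax C (open_nbhs_nbhs (conj oC Cx)).
by case: (CA z Cz).
Qed.
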